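(* Let $K>1$ and consider a linear network with routes $\mathcal{R}=\{r_0,r_1,\dots,r_K\}$, links $\mathcal{J}=\{j_1,\dots,j_K\}$ and link capacities $C=(C_j)_{j\in\mathcal{J}}$, $C_j>0$, with feasible set $\mathcal{C}=\{\Lambda\in\mathbb{R}_+^{\mathcal{R}}: A\Lambda\le C\}$. For each $r\in\mathcal{R}$ let $U_r:\mathbb{R}_+\to\mathbb{R}$ be increasing, once differentiable and strictly concave, and assume that $U_r'$ has range $(0,\infty)$. For $y\in\mathbb{R}_+^{\mathcal{R}}$ let $\Lambda(y)$ be the solution of $$\max\ U(y,\Lambda)\ \text{ over }\ \Lambda\in\mathcal{C},\qquad U(y,\Lambda)=\frac{1}{\sum_{i\in\mathcal{R}} y_i}\sum_{r\in\mathcal{R}} y_r\,U_r\Big(\frac{\Lambda_r}{y_r}\Big).$$ Then the network is flow scalable if and only if it maximizes a weighted $\alpha$-fair utility function, i.e., if and only if there exist $\alpha>0$ and $w\in\mathbb{R}_+^{\mathcal{R}}$ such that, for every $y\in\mathbb{R}_+^{\mathcal{R}}$, $\Lambda(y)$ is the maximizer of $W_{\alpha,w}(y,\Lambda)$ over $\Lambda\in\mathcal{C}$.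
   Context: Here $\mathbb{R}_+=(0,\infty)$. Network: $A$ is the $|\mathcal{J}|\times|\mathcal{R}|$ matrix with $A_{jr}=1$ if route $r$ uses link $j$ and $A_{jr}=0$ otherwise; $y_r$ is the number of flows on route $r$ and $\Lambda_r$ is the bandwidth allocated to route $r$. Linear network: route $r_0$ uses all links ($A_{jr_0}=1$ for all $j\in\mathcal{J}$), and for $k=1,\dots,K$ route $r_k$ uses only link $j_k$ ($A_{j_kr_k}=1$ and $A_{jr_k}=0$ for $j\ne j_k$). Flow scalable: the network (utility function $U$ optimized over the fixed capacity set $\mathcal{C}$) is flow scalable if $\Lambda(y)=\Lambda(ay)$ for all $a>0$ and all $y\in\mathbb{R}_+^{\mathcal{R}}$. Weighted $\alpha$-fair utility functions: for $\alpha>0$ and $w\in\mathbb{R}_+^{\mathcal{R}}$, $$W_{\alpha,w}(y,\Lambda)=\begin{cases}\dfrac{1}{\sum_{i\in\mathcal{R}} y_i}\displaystyle\sum_{r\in\mathcal{R}}\frac{w_r y_r}{1-\alpha}\Big(\frac{\Lambda_r}{y_r}\Big)^{1-\alpha} & \text{if }\alpha\ne 1,\\[2ex] \dfrac{1}{\sum_{i\in\mathcal{R}} y_i}\displaystyle\sum_{r\in\mathcal{R}} w_r y_r\log\Big(\frac{\Lambda_r}{y_r}\Big) & \text{if }\alpha=1.\end{cases}$$ *)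

(* Defs.v *)
From mathcomp Require Import all_boot all_order all_algebra.
From mathcomp Require Import all_classical all_reals all_analysis.

Set Implicit Arguments.
Unset Strict Implicit.
Unset Printing Implicit Defensive.

Import Order.TTheory GRing.Theory Num.Theory.
Import numFieldNormedType.Exports.

Local Open Scope classical_set_scope.
Local Open Scope ring_scope.

(* Vectors indexed by n routes (resp. m links) are column vectors 'cV[R]_n
   (resp. 'cV[R]_m).  The open half-line of positive reals is not a separate
   type: a function on it is a function on R, of which only the values at
   positive arguments are constrained or used. *)

Definition positive_vec (R : realType) (n : nat) (v : 'cV[R]_n) : Prop :=
  forall r, 0 < v r 0.

Definition maximizers (R : realType) (T : Type) (S : set T) (f : T -> R)
  : set T :=
  [set x | S x /\ forall z, S z -> f z <= f x].

Definition feasible (R : realType) (m n : nat) (A : 'M[R]_(m, n))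
  (C : 'cV[R]_m) : set 'cV[R]_n :=
  [set L | positive_vec L /\ forall j, (A *m L) j 0 <= C j 0].

Definition network_utility (R : realType) (n : nat) (U : 'I_n -> R -> R)
  (y L : 'cV[R]_n) : R :=
  (\sum_i y i 0)^-1 * \sum_r y r 0 * U r (L r 0 / y r 0).

(* [get] picks an element of a nonempty set.  For the linear network and the
   utilities considered here, the set of maximizers is a singleton at every
   positive y, so that this is the solution of the optimization problem. *)
Definition allocation (R : realType) (m n : nat) (A : 'M[R]_(m, n))
  (C : 'cV[R]_m) (U : 'I_n -> R -> R) (y : 'cV[R]_n) : 'cV[R]_n :=
  get (maximizers (feasible A C) (network_utility U y)).

Definition flow_scalable (R : realType) (m n : nat) (A : 'M[R]_(m, n))
  (C : 'cV[R]_m) (U : 'I_n -> R -> R) : Prop :=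
  forall (a : R) (y : 'cV[R]_n), 0 < a -> positive_vec y ->
    allocation A C U y = allocation A C U (a *: y).

Definition alpha_fair (R : realType) (n : nat) (alpha : R) (w y L : 'cV[R]_n)
  : R :=
  if alpha == 1 then
    (\sum_i y i 0)^-1 * \sum_r w r 0 * y r 0 * ln (L r 0 / y r 0)
  else
    (\sum_i y i 0)^-1 *
    \sum_r w r 0 * y r 0 / (1 - alpha) * (L r 0 / y r 0) `^ (1 - alpha).

(* Equality with a singleton: the allocation is the maximizer, not merely one
   of the maximizers. *)
Definition maximizes_alpha_fair (R : realType) (m n : nat) (A : 'M[R]_(m, n))
  (C : 'cV[R]_m) (U : 'I_n -> R -> R) (alpha : R) (w : 'cV[R]_n) : Prop :=
  forall y : 'cV[R]_n, positive_vec y ->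
    maximizers (feasible A C) (alpha_fair alpha w y) =
    [set allocation A C U y].

(* Incidence matrix of the linear network: route r_0 is [ord0], and route r_k,
   which uses only link k, is [lift ord0 k] for k : 'I_K. *)
Definition linear_network (R : realType) (K : nat) : 'M[R]_(K, K.+1) :=
  \matrix_(j < K, r < K.+1) ((r == ord0) || (r == lift ord0 j))%:R.

Definition increasing_pos (R : realType) (f : R -> R) : Prop :=
  forall x z : R, 0 < x -> x < z -> f x < f z.

Definition differentiable_pos (R : realType) (f : R -> R) : Prop :=
  forall x : R, 0 < x -> derivable f x 1.

Definition strictly_concave_pos (R : realType) (f : R -> R) : Prop :=
  forall x z t : R, 0 < x -> 0 < z -> x != z -> 0 < t -> t < 1 ->
    t * f x + (1 - t) * f z < f (t * x + (1 - t) * z).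

Definition derivative_range_pos (R : realType) (f : R -> R) : Prop :=
  (derive1 f) @` [set x | 0 < x] = [set v | 0 < v].

(* Main.v *)
Require Import Defs.
From mathcomp Require Import all_boot all_order all_algebra.
From mathcomp Require Import all_classical all_reals all_analysis.
From mathcomp Require Import ring lra.
Import Order.TTheory GRing.Theory Num.Theory.
Import numFieldNormedType.Exports.
Local Open Scope classical_set_scope.
Local Open Scope ring_scope.

(** Write [g r] for the derivative of [U r], a decreasing bijection of the
    positive half-line.  In a linear network the optimal allocation saturates
    every link, and it is the only saturating [L] for which the long route's
    marginal utility equals the sum of those of the short routes
    ([maximizers_tight_balanced], [exists_tight_balanced]):

      g_0 (L_0 / y_0) = g_1 (L_1 / y_1) + ... + g_K (L_K / y_K).

    If the network is flow scalable, the solution set of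
    g_0 (u_0) = g_1 (u_1) + ... + g_K (u_K) in positive u is invariant under
    every scaling u |-> b u ([flow_scalable_balanced]).  Read on the values
    v_k = g_k (u_k), the scaling acts by functions f_k with
    f_0 (v_1 + ... + v_K) = f_1 (v_1) + ... + f_K (v_K).  For K > 1 this
    Pexider equation forces all f_k to be multiplication by one constant c(b)
    ([pexider_pos], [scaled_balance_common_factor]), so
    g_r (b u) = c(b) g_r (u).  The factor c is multiplicative and decreasing,
    hence c(b) = b^(-alpha) with alpha > 0, and g_r (u) = g_r (1) u^(-alpha):
    each U_r is, up to a constant, the isoelastic utility of weight g_r (1)
    ([common_factor_powR], [eq_derive_pos_increment]).

    Conversely, multiplying y by a > 0 changes the weighted alpha-fair objective
    by an increasing affine map, which does not move its maximizer
    ([maximizers_alpha_fair_scale]). *)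

(** * Derivatives of strictly concave functions *)

Definition strict_supergradient_pos {R : realType} (f g : R -> R) : Prop :=
  forall x z : R, 0 < x -> 0 < z -> x != z -> f z < f x + g x * (z - x).

(** Concavity bounds the chord from [x] to [z] by every shorter chord issued
    from [x]; letting the latter shrink gives the tangent at [x]. *)
Lemma concave_le_derive1 {R : realType} (f : R -> R) (x z : R) :
  derivable f x 1 ->
  (forall t, 0 < t -> t < 1 -> t * f z + (1 - t) * f x <= f (t * z + (1 - t) * x)) ->
  f z - f x <= derive1 f x * (z - x).
Proof.
move=> df conc; rewrite derive1E.
have [->|xz] := eqVneq z x; first by rewrite !subrr mulr0.
have dz : z - x != 0 by rewrite subr_eq0.
rewrite leNgt; apply/negP => lt_d.
(* If the tangent lay strictly below the chord, [e] would be the gap between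
   the two slopes, and a short enough chord would have a slope closer to the
   derivative than that. *)
pose e := (f z - f x - 'D_1 f x * (z - x)) / `|z - x|.
have e_gt0 : 0 < e by rewrite divr_gt0 ?subr_gt0 ?normr_gt0.
have := df; rewrite /derivable => /cvgrPdist_lt /(_ e e_gt0).
rewrite near_withinE => /nbhs_ballP[d /= d_gt0 dP].
pose t := Num.min (1 / 2) (d / 2 / `|z - x|).
have t_gt0 : 0 < t by rewrite lt_min !divr_gt0 ?normr_gt0.
have t_lt1 : t < 1 by rewrite gt_min ltr_pdivrMr ?mul1r ?ltr1n ?ltr0n.
have tne0 : t != 0 by rewrite gt_eqF.
have near_quot : `|'D_1 f x - (t * (z - x))^-1 * (f (t * (z - x) + x) - f x)| < e.
  have := dP (t * (z - x)); rewrite /= [_ *: 1]mulr1; apply;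
    last by rewrite mulf_neq0.
  rewrite /ball /= sub0r normrN normrM (gtr0_norm t_gt0).
  rewrite -ltr_pdivlMr ?normr_gt0//; apply: (@le_lt_trans _ _ (d / 2 / `|z - x|)).
    by rewrite /t ge_min lexx orbT.
  by rewrite ltr_pM2r ?invr_gt0 ?normr_gt0// ltr_pdivrMr// ltr_pMr// ltr1n.
have := conc t t_gt0 t_lt1.
have -> : t * z + (1 - t) * x = t * (z - x) + x by ring.
move: near_quot; set q := f (_ + _).
rewrite /e distrC ltr_pdivlMr ?normr_gt0// -normrM => /(le_lt_trans (ler_norm _)).
rewrite mulrBl invfM.
have -> : t^-1 / (z - x) * (q - f x) * (z - x) = (q - f x) / t.
  by field; rewrite dz tne0.
rewrite ltrD2r ltr_pdivrMr// => h; nra.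
Qed.

(** Strictness is gained at the midpoint: the graph lies strictly above the
    chord there, and still weakly below the tangent. *)
Lemma strict_supergradient_derive1 {R : realType} (f : R -> R) :
  differentiable_pos f -> strictly_concave_pos f ->
  strict_supergradient_pos f (derive1 f).
Proof.
move=> df cf x z x0 z0 xz.
have h2 : (0 < 2^-1 :> R) by rewrite invr_gt0.
have h21 : (2^-1 < 1 :> R) by rewrite invf_lt1 ?ltr1n.
have := cf z x 2^-1 z0 x0 _ h2 h21; rewrite eq_sym => /(_ xz).
set m := _ + _ * x => hm.
have m0 : 0 < m by rewrite /m; nra.
have xm : x != m.
  by apply: contra xz => /eqP xm; apply/eqP; move: xm; rewrite /m => ?; lra.
have : f m - f x <= derive1 f x * (m - x).
  apply: concave_le_derive1; first exact: df.
  by move=> t t0 t1; apply/ltW/cf => //; rewrite eq_sym.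
have -> : m - x = 2^-1 * (z - x) by rewrite /m; field.
by move=> h; lra.
Qed.

(** Adding the tangent inequalities at [x] and at [z] leaves
    [(g x - g z) * (z - x) > 0]. *)
Lemma strict_supergradient_decr {R : realType} (f g : R -> R) :
  strict_supergradient_pos f g ->
  forall x z, 0 < x -> x < z -> g z < g x.
Proof.
move=> fg x z x0 xz; have z0 := lt_trans x0 xz.
have h1 := fg x z x0 z0 (negbT (lt_eqF xz)).
have h2 := fg z x z0 x0 (negbT (gt_eqF xz)).
by nra.
Qed.

(** The properties of a marginal utility that the proof uses, once
    differentiability of the utility has been exploited. *)
Definition pos_decreasing_bijection {R : realType} (g : R -> R) : Prop :=
  [/\ forall x, 0 < x -> 0 < g x,
      forall x z, 0 < x -> x < z -> g z < g x &
      forall v, 0 < v -> exists2 x, 0 < x & g x = v].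

Lemma decr_le {R : realType} (g : R -> R) (hg : pos_decreasing_bijection g) x z :
  0 < x -> x <= z -> g z <= g x.
Proof.
case: hg => _ gd _ x0; rewrite le_eqVlt => /predU1P[->//|xz].
exact/ltW/gd.
Qed.

Lemma decr_lt_cancel {R : realType} (g : R -> R)
    (hg : pos_decreasing_bijection g) x z :
  0 < x -> g x < g z -> z < x.
Proof. by move=> x0; apply: contraTT; rewrite -!leNgt; exact: (decr_le g hg). Qed.

Lemma decr_inj {R : realType} (g : R -> R) (hg : pos_decreasing_bijection g) x z :
  0 < x -> 0 < z -> g x = g z -> x = z.
Proof.
case: hg => _ gd _ x0 z0 e; have [xz|zx|//] := ltgtP x z.
  by have := gd _ _ x0 xz; rewrite e ltxx.
by have := gd _ _ z0 zx; rewrite e ltxx.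
Qed.

(** A monotone function onto an interval has no jumps: values close to [g x]
    on either side are attained, and their preimages bound a neighbourhood
    of [x]. *)
Lemma decr_surj_continuous {R : realType} (g : R -> R)
    (hg : pos_decreasing_bijection g) (x : R) :
  0 < x -> {for x, continuous g}.
Proof.
move=> x0; case: (hg) => gp gd gs.
apply/cvgrPdist_lt => e e0; have gx0 := gp _ x0.
have [u u0 gu] : exists2 u, 0 < u & g u = g x + e / 2 by apply: gs; lra.
(* The maximum keeps the lower target value positive, so that it is attained. *)
have [v v0 gv] : exists2 v, 0 < v & g v = Num.max (g x - e / 2) (g x / 2).
  by apply: gs; rewrite lt_max orbC divr_gt0.
have ux : u < x by apply: (decr_lt_cancel g hg) => //; rewrite gu; lra.
have xv : x < v.
  by apply: (decr_lt_cancel g hg) => //; rewrite gv gt_max; apply/andP; split; lra.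
have : \forall z \near x, z \in `]u, v[ by apply: near_in_itvoo; rewrite in_itv/= ux.
apply: filterS => z; rewrite in_itv/= => /andP[uz zv].
have z0 : 0 < z by exact: lt_trans uz.
have h1 := gd _ _ u0 uz; have h2 := gd _ _ z0 zv.
have h3 : g x - e / 2 <= g v by rewrite gv le_max lexx.
by rewrite ltr_norml; apply/andP; split; lra.
Qed.

(** * Functional equations on the positive half-line *)

(** An additive positive function is increasing, so the integers around
    [n * v] enclose [n * f v] within [f 1] of [n * (f 1 * v)], for every [n]. *)
Lemma cauchy_additive_pos {R : realType} (f : R -> R) :
  (forall v, 0 < v -> 0 < f v) ->
  (forall v w, 0 < v -> 0 < w -> f (v + w) = f v + f w) ->
  forall v, 0 < v -> f v = f 1 * v.
Proof.
move=> fp fD.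
have fn n v : 0 < v -> f (n.+1%:R * v) = n.+1%:R * f v.
  move=> v0; elim: n => [|n IH]; first by rewrite !mul1r.
  rewrite -natr1 !mulrDl !mul1r fD ?IH//.
  by rewrite mulr_gt0.
have fle v w : 0 < v -> v <= w -> f v <= f w.
  move=> v0; rewrite le_eqVlt => /predU1P[->//|vw].
  rewrite -[w](subrKC v) fD ?subr_gt0// lerDl.
  by apply/ltW/fp; rewrite subr_gt0.
have close v n : 0 < v -> n.+1%:R * `|f v - f 1 * v| <= f 1.
  move=> v0; have f1 := fp 1 ltr01.
  have nv0 : 0 < n.+1%:R * v by rewrite mulr_gt0.
  rewrite -[n.+1%:R]ger0_norm// -normrM mulrBr -fn// mulrCA.
  have := truncn_itv (ltW nv0); set w := n.+1%:R * v in nv0 *.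
  case: (Num.truncn w) => [|m] /andP[mw wm].
    have := fle _ _ nv0 (ltW wm); have := fp _ nv0 => *.
    by rewrite ler_norml; apply/andP; split; nra.
  have m0 : 0 < m.+1%:R :> R by [].
  have := fle _ _ m0 mw; have := fle _ _ nv0 (ltW wm).
  rewrite -[m.+1%:R]mulr1 -[m.+2%:R]mulr1 !fn//.
  rewrite -natr1 in wm *; set M := m.+1%:R in m0 mw wm *.
  by move=> h1 h2; rewrite ler_norml; apply/andP; split; nra.
move=> v v0; apply/eqP; rewrite -subr_eq0 -normr_le0 leNgt; apply/negP => d0.
have := close v (Num.truncn (f 1 / `|f v - f 1 * v|)) v0.
rewrite leNgt => /negP; apply; rewrite -ltr_pdivrMr//.
by apply: truncnS_gt.
Qed.

(** The increment [f (v + w) - f v] depends on [w] only, so by symmetry [f - D]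
    is a constant [d], which is to vanish.  As [f] is monotone and takes
    arbitrarily small values, [d > 0] is impossible; [d < 0] would make every
    increment at least [- d], and [f] would skip values. *)
Lemma increment_translation_additive {R : realType} (f D : R -> R) :
  (forall v, 0 < v -> 0 < f v) ->
  (forall v w, 0 < v -> v <= w -> f v <= f w) ->
  (forall e, 0 < e -> exists2 v, 0 < v & f v = e) ->
  (forall v w, 0 < v -> 0 < w -> f (v + w) = f v + D w) ->
  forall v, 0 < v -> f v = D v.
Proof.
move=> fp fle fs fD.
have fDE v : 0 < v -> f v - D v = f 1 - D 1.
  move=> v0; have := fD 1 v ltr01 v0; rewrite addrC fD// => ?; lra.
set d := f 1 - D 1 in fDE.
suff d0 : d = 0.
  by move=> v v0; apply/eqP; rewrite -subr_eq0 fDE// d0.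
apply/eqP; rewrite eq_le; apply/andP; split; rewrite leNgt; apply/negP => d0.
  have [v v0 fv] := fs (d / 2) ltac:(lra).
  have := fle 1 (v + 1) ltr01 ltac:(lra); rewrite fD// fv.
  by have := fDE 1 ltr01 => *; lra.
have [u u0 fu] := fs (f 1 - d / 2) ltac:(have := fp 1 ltr01; lra).
have u1 : 1 < u.
  by rewrite ltNge; apply/negP => u1; have := fle u 1 u0 u1; rewrite fu => ?; lra.
have u10 : 0 < u - 1 by rewrite subr_gt0.
have := fD 1 (u - 1) ltr01 u10; rewrite subrKC fu.
by have := fDE _ u10; have := fp _ u10 => *; lra.
Qed.

(** Pexider's equation.  With at least two variables, an increment can be moved
    from one variable to another without changing the sum; hence the increments
    of every [f k] are independent of the base point, and common to all [k].
    With one variable the equation would only say [h = f]: this is where two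
    links or more are required. *)
Lemma pexider_pos {R : realType} (K : nat) (hK : (1 < K)%N)
    (f : 'I_K -> R -> R) (h : R -> R) :
  (forall k v, 0 < v -> 0 < f k v) ->
  (forall k v w, 0 < v -> v <= w -> f k v <= f k w) ->
  (forall k e, 0 < e -> exists2 v, 0 < v & f k v = e) ->
  (forall v : 'I_K -> R, (forall k, 0 < v k) -> h (\sum_k v k) = \sum_k f k (v k)) ->
  exists c, [/\ 0 < c, forall k v, 0 < v -> f k v = c * v &
    forall v, 0 < v -> h v = c * v].
Proof.
move=> fp fle fs fh.
have swap (i j : 'I_K) v w d : i != j -> 0 < v -> 0 < w -> 0 < d ->
    f i (v + d) + f j w = f i v + f j (w + d).
  move=> ij v0 w0 d0.
  pose P a b k := if k == i then a else if k == j then b else (1 : R).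
  have P0 a b : 0 < a -> 0 < b -> forall k, 0 < P a b k.
    by move=> a0 b0 k; rewrite /P; case: eqP => // _; case: eqP.
  have Psum (F : 'I_K -> R -> R) a b : \sum_k F k (P a b k) =
      F i a + (F j b + \sum_(k | (k != i) && (k != j)) F k 1).
    rewrite (bigD1 i)//= (bigD1 j) 1?eq_sym//= /P eqxx eq_sym (negbTE ij) eqxx.
    congr (_ + (_ + _)); apply: eq_bigr => k /andP[/negbTE-> /negbTE->] //.
  have h1 := fh _ (P0 (v + d) w ltac:(lra) w0).
  have h2 := fh _ (P0 v (w + d) v0 ltac:(lra)).
  have e : \sum_k P (v + d) w k = \sum_k P v (w + d) k.
    by rewrite !(Psum (fun _ x => x)); lra.
  by move: h1; rewrite e h2 !Psum; lra.
have other (i : 'I_K) : exists j : 'I_K, i != j.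
  have K0 : (0 < K)%N by exact: ltnW.
  have [->|] := eqVneq i (Ordinal K0); first by exists (Ordinal hK).
  by exists (Ordinal K0).
have fE i v : 0 < v -> f i v = f i 1 * v.
  apply: cauchy_additive_pos => [|{}v w v0 w0]; first exact: fp.
  have [j ij] := other i.
  pose D d := f j (1 + d) - f j 1.
  have fD a d : 0 < a -> 0 < d -> f i (a + d) = f i a + D d.
    by move=> a0 d0; have := swap i j a 1 d ij a0 ltr01 d0; rewrite /D => ?; lra.
  by rewrite fD// -(increment_translation_additive _ _ (fp i) (fle i) (fs i) fD).
have fij i j : f i 1 = f j 1.
  have [->//|ij] := eqVneq i j.
  have := swap i j 1 1 1 ij ltr01 ltr01 ltr01.
  rewrite (fE i (1 + 1)) ?(fE j (1 + 1)) ?addr_gt0// => ?; lra.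
have K0 : (0 < K)%N by exact: ltnW.
have K0R : 0 < K%:R :> R by rewrite ltr0n.
exists (f (Ordinal K0) 1); split; first exact: fp.
- by move=> k v v0; rewrite fE// (fij k (Ordinal K0)).
- move=> v v0; have vK : 0 < v / K%:R by rewrite divr_gt0.
  have := fh (fun=> v / K%:R) (fun=> vK).
  under [in RHS]eq_bigr => k _ do rewrite fE// (fij k (Ordinal K0)).
  have eK : v / K%:R *+ K = v by rewrite -mulr_natr divfK// gt_eqF.
  by rewrite !sumr_const card_ord eK -mulrnAr eK.
Qed.

(** In logarithmic coordinates, [c] becomes minus an additive positive function.
    Additivity and positivity hold at positive arguments, that is, for
    arguments of [c] beyond [1]; reciprocals give the rest. *)
Lemma multiplicative_decreasing_powR {R : realType} (c : R -> R) :
  (forall x, 0 < x -> 0 < c x) ->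
  (forall x z, 0 < x -> x < z -> c z < c x) ->
  (forall x z, 0 < x -> 0 < z -> c (x * z) = c x * c z) ->
  exists2 a, 0 < a & forall x, 0 < x -> c x = x `^ (- a).
Proof.
move=> cp cd cM.
have c1 : c 1 = 1.
  have := cM 1 1 ltr01 ltr01; rewrite mulr1 => e.
  by apply: (mulfI (lt0r_neq0 (cp 1 ltr01))); rewrite -e mulr1.
pose L t := - ln (c (expR t)).
have Lp t : 0 < t -> 0 < L t.
  move=> t0; rewrite /L oppr_gt0 ln_lt0// cp ?expR_gt0//=.
  by rewrite -c1; apply: cd => //; rewrite expR_gt1.
have LD t s : 0 < t -> 0 < s -> L (t + s) = L t + L s.
  move=> t0 s0; rewrite /L expRD cM ?expR_gt0// lnM ?posrE ?cp ?expR_gt0//.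
  by rewrite opprD.
have LE := cauchy_additive_pos L Lp LD.
exists (L 1); first exact: Lp.
have gt1 x : 1 < x -> c x = x `^ (- L 1).
  move=> x1; have x0 : 0 < x by exact: lt_trans x1.
  rewrite /powR gt_eqF// mulNr -LE ?ln_gt0// /L opprK.
  by rewrite (@lnK _ x) ?posrE// lnK ?posrE ?cp.
move: (L 1) gt1 => a gt1 x x0; have [x1|x1|->] := ltgtP x 1; last 2 first.
- exact: gt1.
- by rewrite c1 powR1.
have xi : 0 < x^-1 by rewrite invr_gt0.
have := cM x x^-1 x0 xi; rewrite mulfV ?gt_eqF// c1 (gt1 x^-1) ?invf_gt1//.
rewrite -powR_inv1 ?ltW// -powRrM mulN1r opprK => e.
rewrite powRN -div1r; apply: (canRL (mulfK _)); last by rewrite -e.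
by rewrite gt_eqF// powR_gt0.
Qed.

(** * The optimal allocation of a linear network *)

Lemma linear_network_load {R : realType} {K : nat} (L : 'cV[R]_K.+1) (j : 'I_K) :
  (linear_network R K *m L) j 0 = L ord0 0 + L (lift ord0 j) 0.
Proof.
rewrite mxE big_ord_recl mxE eqxx mul1r; congr (_ + _).
rewrite (bigD1 j)//= big1 ?addr0 => [|k kj]; rewrite mxE.
  by rewrite eqxx orbT mul1r.
by rewrite (inj_eq lift_inj) (negbTE kj) mul0r.
Qed.

Definition tight {R : realType} {K : nat} (C : 'cV[R]_K) (L : 'cV[R]_K.+1) : Prop :=
  forall k, L ord0 0 + L (lift ord0 k) 0 = C k 0.

(** First-order optimality in terms of the bandwidths per flow [u r]: shifting
    bandwidth to the long route takes the same amount from every short one, so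
    its marginal utility must be the sum of theirs. *)
Definition balanced {R : realType} {K : nat} (g : 'I_K.+1 -> R -> R)
    (u : 'I_K.+1 -> R) : Prop :=
  g ord0 (u ord0) = \sum_(k < K) g (lift ord0 k) (u (lift ord0 k)).

(** The marginal utilities [p r] of the short routes are the link prices
    (Lagrange multipliers), and [balanced] says that the long route pays the sum
    of all prices.  The linear functional with coefficients [p r] is then
    maximal on the feasible set at every tight point, and the strict tangent
    inequality turns this into strict optimality of [L]. *)
Lemma maximizers_tight_balanced {R : realType} {K : nat}
    (V g : 'I_K.+1 -> R -> R) (C : 'cV[R]_K) (y L : 'cV[R]_K.+1) :
  (forall r, strict_supergradient_pos (V r) (g r)) ->
  (forall r x, 0 < x -> 0 < g r x) ->
  positive_vec y -> positive_vec L -> tight C L ->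
  balanced g (fun r => L r 0 / y r 0) ->
  maximizers (feasible (linear_network R K) C) (network_utility V y) = [set L].
Proof.
move=> hV gp y0 L0 tL bL.
pose p r := g r (L r 0 / y r 0).
have p0 r : 0 < p r by apply/gp/divr_gt0.
have Lfeas : feasible (linear_network R K) C L.
  by split=> // j; rewrite linear_network_load tL.
have price z : feasible (linear_network R K) C z ->
    \sum_r p r * (z r 0 - L r 0) <= 0.
  move=> [_ zC]; rewrite big_ord_recl {1}/p bL mulr_suml -big_split/=.
  apply: sumr_le0 => k _; rewrite -mulrDr; apply: mulr_ge0_le0; first exact/ltW/p0.
  by have := zC k; rewrite linear_network_load -tL; lra.
have term z r : 0 < z r 0 -> z r 0 != L r 0 ->
    y r 0 * V r (z r 0 / y r 0) <
    y r 0 * V r (L r 0 / y r 0) + p r * (z r 0 - L r 0).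
  move=> z0 zL; have yr := y0 r.
  have zL' : L r 0 / y r 0 != z r 0 / y r 0.
    by apply: contra zL => /eqP/(divIf (lt0r_neq0 yr)) ->.
  have := hV r _ _ (divr_gt0 (L0 r) yr) (divr_gt0 z0 yr) zL'.
  rewrite -(ltr_pM2l yr) => /lt_le_trans; apply; rewrite mulrDr -/(p r) lerD2l.
  by rewrite le_eqVlt; apply/orP; left; apply/eqP; field; exact: lt0r_neq0.
have term_le z r : 0 < z r 0 ->
    y r 0 * V r (z r 0 / y r 0) <=
    y r 0 * V r (L r 0 / y r 0) + p r * (z r 0 - L r 0).
  have [->|zL] := eqVneq (z r 0) (L r 0); first by rewrite subrr mulr0 addr0.
  by move=> z0; exact/ltW/term.
have ysum : 0 < (\sum_i y i 0)^-1.
  rewrite invr_gt0 big_ord_recl ltr_wpDr//.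
  by apply: sumr_ge0 => i _; exact/ltW.
have lt_max z : feasible (linear_network R K) C z -> z <> L ->
    network_utility V y z < network_utility V y L.
  move=> zf zL; have [z0 _] := zf; rewrite /network_utility ltr_pM2l//.
  have [r zLr] : exists r, z r 0 != L r 0.
    apply: contrapT => noex; apply: zL; apply/colP => r.
    by apply/eqP/negPn/negP => zr; apply: noex; exists r.
  have : \sum_r y r 0 * V r (z r 0 / y r 0) <
      \sum_r (y r 0 * V r (L r 0 / y r 0) + p r * (z r 0 - L r 0)).
    rewrite (bigD1 r)//= [ltRHS](bigD1 r)//=; apply: ltr_leD; first exact: term.
    by apply: ler_sum => s _; exact: term_le.
  move/lt_le_trans; apply; rewrite big_split/= gerDl; exact: price.
apply/seteqP; split=> z /=.
  move=> [zf zmax]; apply: contrapT => zL.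
  by have := lt_le_trans (lt_max z zf zL) (zmax L Lfeas); rewrite ltxx.
move=> ->; split=> // x xf; have [->//|/eqP xL] := eqVneq x L.
exact/ltW/lt_max.
Qed.

Lemma allocation_maximizers1 {R : realType} {m n : nat} (A : 'M[R]_(m, n))
    (C : 'cV[R]_m) (U : 'I_n -> R -> R) (y L : 'cV[R]_n) :
  maximizers (feasible A C) (network_utility U y) = [set L] ->
  allocation A C U y = L.
Proof. by rewrite /allocation => ->; apply: get_unique. Qed.

(** The tight vectors form a one-parameter family, indexed by the bandwidth [x]
    of the long route. *)
Definition tight_vec {R : realType} {K : nat} (C : 'cV[R]_K) (x : R) : 'cV[R]_K.+1 :=
  \col_r oapp (fun k => C k 0 - x) x (unlift ord0 r).

Lemma tight_vec0 {R : realType} {K : nat} (C : 'cV[R]_K) x :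
  tight_vec C x ord0 0 = x.
Proof. by rewrite mxE unlift_none. Qed.

Lemma tight_vec_lift {R : realType} {K : nat} (C : 'cV[R]_K) x k :
  tight_vec C x (lift ord0 k) 0 = C k 0 - x.
Proof. by rewrite mxE liftK. Qed.

Lemma tight_tight_vec {R : realType} {K : nat} (C : 'cV[R]_K) x :
  tight C (tight_vec C x).
Proof. by move=> k; rewrite tight_vec0 tight_vec_lift subrKC. Qed.

Lemma positive_tight_vec {R : realType} {K : nat} (C : 'cV[R]_K) x :
  0 < x -> (forall k, x < C k 0) -> positive_vec (tight_vec C x).
Proof.
move=> x0 xC r; rewrite mxE; case: unliftP => [k _|_] //=.
by rewrite subr_gt0.
Qed.

Lemma exists_bottleneck {R : realType} {K : nat} (C : 'cV[R]_K) :
  (0 < K)%N -> exists k0, forall k, C k0 0 <= C k 0.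
Proof.
move=> K0; case: (arg_minP (fun k => C k 0) (erefl : xpredT (Ordinal K0))).
by move=> k0 _ h; exists k0 => k; exact: h.
Qed.

(** Along the tight vectors, the excess [F x] of the marginal utility of the
    long route over those of the short ones is continuous; it is nonnegative for
    small [x], where the long route starves, and nonpositive for [x] close to
    the least capacity [m], where a bottleneck route starves.  The intermediate
    value theorem applies. *)
Lemma exists_tight_balanced {R : realType} {K : nat} (g : 'I_K.+1 -> R -> R)
    (C : 'cV[R]_K) (y : 'cV[R]_K.+1) :
  (0 < K)%N -> (forall r, pos_decreasing_bijection (g r)) ->
  positive_vec C -> positive_vec y ->
  exists L, [/\ positive_vec L, tight C L & balanced g (fun r => L r 0 / y r 0)].
Proof.
move=> K0 hg C0 y0.
have gp r : forall x, 0 < x -> 0 < g r x by case: (hg r).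
have gs r : forall v, 0 < v -> exists2 x, 0 < x & g r x = v by case: (hg r).
have gle r := decr_le (g r) (hg r).
have [k0 k0min] := exists_bottleneck C K0.
set m := C k0 0 in k0min; have m0 : 0 < m := C0 k0.
pose S x := \sum_k g (lift ord0 k) ((C k 0 - x) / y (lift ord0 k) 0).
pose F x := g ord0 (x / y ord0 0) - S x.
have arg_gt0 x k : x < m -> 0 < (C k 0 - x) / y (lift ord0 k) 0.
  by move=> xm; rewrite divr_gt0// subr_gt0; exact: lt_le_trans (k0min k).
have S_gt x k : x < m -> g (lift ord0 k) ((C k 0 - x) / y (lift ord0 k) 0) <= S x.
  move=> xm; rewrite /S (bigD1 k)//= lerDl; apply: sumr_ge0 => j _.
  exact/ltW/gp/arg_gt0.
have S_gt0 x : x < m -> 0 < S x.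
  by move=> xm; apply: lt_le_trans (S_gt x k0 xm); exact/gp/arg_gt0.
have S_le x z : x <= z -> z < m -> S x <= S z.
  move=> xz zm; apply: ler_sum => k _; apply: gle; first exact: arg_gt0.
  by rewrite ler_pM2r ?invr_gt0// lerD2l lerN2.
have m2 : m / 2 < m by lra.
have m20 : 0 < m / 2 by lra.
have [a [a0 am Fa]] : exists a, [/\ 0 < a, a <= m / 2 & 0 <= F a].
  have [z z0 gz] := gs ord0 _ (S_gt0 _ m2).
  have a0 : 0 < Num.min (m / 2) (y ord0 0 * z) by rewrite lt_min m20 mulr_gt0.
  have am : Num.min (m / 2) (y ord0 0 * z) <= m / 2 by rewrite ge_min lexx.
  exists (Num.min (m / 2) (y ord0 0 * z)); split=> //; rewrite subr_ge0.
  apply: (le_trans (S_le _ _ am m2)); rewrite -gz; apply: gle; first exact: divr_gt0.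
  by rewrite ler_pdivrMr// [z * _]mulrC ge_min lexx orbT.
have [b [bm mb Fb]] : exists b, [/\ b < m, m / 2 <= b & F b <= 0].
  have [z z0 gz] := gs (lift ord0 k0) _ (gp ord0 _ (divr_gt0 m20 (y0 ord0))).
  pose b := Num.max (m / 2) (m - y (lift ord0 k0) 0 * z).
  have bm : b < m by rewrite gt_max m2 ltrBlDr ltrDl mulr_gt0.
  have mb : m / 2 <= b by rewrite le_max lexx.
  exists b; split=> //; rewrite subr_le0; apply: le_trans (S_gt b k0 bm).
  apply: (@le_trans _ _ (g ord0 (m / 2 / y ord0 0))).
    by apply: gle; [exact: divr_gt0|rewrite ler_pM2r ?invr_gt0].
  rewrite -gz; apply: gle; first exact: arg_gt0.
  by rewrite ler_pdivrMr// [z * _]mulrC lerBlDr addrC -lerBlDr le_max lexx orbT.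
have cF : {within `[a, b], continuous F}.
  apply: continuous_in_subspaceT => x; rewrite inE/= in_itv/= => /andP[ax xb].
  have x0 : 0 < x by exact: lt_le_trans ax.
  have xm : x < m by exact: le_lt_trans bm.
  have c0 : {for x, continuous (fun t : R => g ord0 (t / y ord0 0))}.
    apply: (@continuous_comp _ _ _ (fun t : R => t / y ord0 0) (g ord0)).
      exact: mulrr_continuous.
    by apply: decr_surj_continuous => //; exact: divr_gt0.
  have ck k : {for x, continuous
      (fun t : R => g (lift ord0 k) ((C k 0 - t) / y (lift ord0 k) 0))}.
    apply: (@continuous_comp _ _ _ (fun t : R => (C k 0 - t) / y (lift ord0 k) 0)
        (g (lift ord0 k))).
      apply: continuousM; last exact: cst_continuous.
      by apply: continuousB; [exact: cst_continuous|exact: id].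
    by apply: decr_surj_continuous => //; exact: arg_gt0.
  apply: cvgB; first exact: c0.
  by apply: cvg_big => [|k _]; [exact: add_continuous|exact: ck].
have [x] : exists2 x, x \in `[a, b] & F x = 0.
  apply: IVT => //; first exact: le_trans mb.
  by rewrite ge_min le_max Fa Fb orbT.
rewrite in_itv/= => /andP[ax xb] Fx.
have x0 : 0 < x by exact: lt_le_trans ax.
have xm : x < m by exact: le_lt_trans bm.
exists (tight_vec C x); split; last 1 first.
- rewrite /balanced tight_vec0; under eq_bigr do rewrite tight_vec_lift.
  by apply/eqP; rewrite -subr_eq0; apply/eqP.
- by apply: positive_tight_vec => // k; exact: lt_le_trans (k0min k).
- exact: tight_tight_vec.
Qed.

(** Any balanced [u] is the vector of bandwidths per flow at an optimum: choose a
    tight [L], then [y r = L r / u r].  Flow scalability keeps [L] optimal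
    when [y] is divided by [b], which multiplies [u] by [b], and optimality
    forces the balance. *)
Lemma flow_scalable_balanced {R : realType} {K : nat}
    (V g : 'I_K.+1 -> R -> R) (C : 'cV[R]_K) :
  (0 < K)%N -> positive_vec C ->
  (forall r, strict_supergradient_pos (V r) (g r)) ->
  (forall r, pos_decreasing_bijection (g r)) ->
  flow_scalable (linear_network R K) C V ->
  forall (u : 'I_K.+1 -> R) b, (forall r, 0 < u r) -> 0 < b ->
    balanced g u -> balanced g (fun r => b * u r).
Proof.
move=> K0 C0 hV hg fs u b u0 b0 bu.
have gp r : forall x, 0 < x -> 0 < g r x by case: (hg r).
have [k0 k0min] := exists_bottleneck C K0.
pose L := tight_vec C (C k0 0 / 2).
have Ck0 := C0 k0.
have L0 : positive_vec L.
  apply: positive_tight_vec => [|k]; first by rewrite divr_gt0.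
  by have := k0min k; lra.
pose y : 'cV[R]_K.+1 := \col_r (L r 0 / u r).
have yE r : y r 0 = L r 0 / u r by rewrite [LHS]mxE.
have y0 : positive_vec y by move=> r; rewrite yE divr_gt0.
have ayE r : (b^-1 *: y) r 0 = b^-1 * y r 0 by rewrite [LHS]mxE.
have ay0 : positive_vec (b^-1 *: y).
  by move=> r; rewrite ayE mulr_gt0// invr_gt0.
have uE : (fun r => L r 0 / y r 0) = u.
  apply/funext => r; rewrite yE; move: (L r 0) (u r) (L0 r) (u0 r) => l v l0 v0.
  by field; rewrite !lt0r_neq0.
have alloc_y : allocation (linear_network R K) C V y = L.
  apply: allocation_maximizers1; apply: maximizers_tight_balanced hV gp y0 L0 _ _.
    exact: tight_tight_vec.
  by rewrite uE.
have [L' [L'0 tL' bL']] := exists_tight_balanced g C _ K0 hg C0 ay0.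
have alloc_ay : allocation (linear_network R K) C V (b^-1 *: y) = L'.
  by apply: allocation_maximizers1;
     apply: maximizers_tight_balanced hV gp ay0 L'0 tL' bL'.
have LL' : L' = L.
  by rewrite -alloc_ay -alloc_y; symmetry; apply: fs; rewrite ?invr_gt0.
rewrite (_ : (fun r => b * u r) = (fun r => L' r 0 / (b^-1 *: y) r 0))//.
apply/funext => r; rewrite LL' ayE yE.
move: (L r 0) (u r) (L0 r) (u0 r) => l v l0 v0.
by field; rewrite !lt0r_neq0.
Qed.

(** Read on marginal utilities, scaling by [b] acts through the functions
    [f r v = g r (b * (g r)^-1 v)].  Choosing the values of the short routes
    freely and their sum for the long one gives every balanced vector, so the
    invariance of the balance is Pexider's equation for the [f r]. *)
Lemma scaled_balance_common_factor {R : realType} {K : nat}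
    (g : 'I_K.+1 -> R -> R) b :
  (1 < K)%N -> (forall r, pos_decreasing_bijection (g r)) -> 0 < b ->
  (forall u, (forall r, 0 < u r) -> balanced g u -> balanced g (fun r => b * u r)) ->
  exists2 c, 0 < c & forall r x, 0 < x -> g r (b * x) = c * g r x.
Proof.
move=> hK hg b0 gb.
have gp r : forall x, 0 < x -> 0 < g r x by case: (hg r).
have gs r : forall v, 0 < v -> exists2 x, 0 < x & g r x = v by case: (hg r).
have gle r := decr_le (g r) (hg r).
have gcan r := decr_lt_cancel (g r) (hg r).
have /choice[inv invP] : forall rv : 'I_K.+1 * R, exists x,
    0 < rv.2 -> 0 < x /\ g rv.1 x = rv.2.
  move=> [r v]; have [v0|v0] := pselect (0 < v); last by exists 0.
  by have [x x0 gx] := gs r v v0; exists x.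
pose f r v := g r (b * inv (r, v)).
have inv0 r v : 0 < v -> 0 < inv (r, v) by move=> v0; case: (invP (r, v) v0).
have invK r v : 0 < v -> g r (inv (r, v)) = v by move=> v0; case: (invP (r, v) v0).
have fg r x : 0 < x -> f r (g r x) = g r (b * x).
  move=> x0; rewrite /f; congr (g r (b * _)).
  by apply: (decr_inj (g r) (hg r)); rewrite ?invK// ?inv0// gp.
have f0 r v : 0 < v -> 0 < f r v by move=> v0; rewrite /f gp// mulr_gt0// inv0.
have fle r v w : 0 < v -> v <= w -> f r v <= f r w.
  move=> v0; rewrite le_eqVlt => /predU1P[->//|vw].
  have w0 : 0 < w by exact: lt_trans vw.
  apply: gle; first by rewrite mulr_gt0// inv0.
  by rewrite ler_pM2l//; apply/ltW/(gcan r); rewrite ?inv0// !invK.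
have fsurj r e : 0 < e -> exists2 v, 0 < v & f r v = e.
  move=> e0; have [x x0 gx] := gs r e e0.
  have xb : 0 < x / b by rewrite divr_gt0.
  exists (g r (x / b)); first exact: gp.
  by rewrite fg// mulrC divfK// lt0r_neq0.
have [v|c [c0 fc hc]] := @pexider_pos R K hK (fun k => f (lift ord0 k)) (f ord0)
    (fun k => f0 _) (fun k => fle _) (fun k => fsurj _) _.
  move=> v0.
  have K0 : (0 < K)%N by exact: ltnW.
  have S0 : 0 < \sum_k v k.
    rewrite (bigD1 (Ordinal K0))//= ltr_wpDr//.
    by apply: sumr_ge0 => k _; exact/ltW.
  pose u r := inv (r, oapp v (\sum_k v k) (unlift ord0 r)).
  have u0 r : 0 < u r by apply: inv0; case: (unlift ord0 r) => [k|] /=.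
  have bu : balanced g u.
    rewrite /balanced /u unlift_none/= invK//; apply: eq_bigr => k _.
    by rewrite liftK/= invK.
  have := gb u u0 bu; rewrite /balanced /u unlift_none/= => e; rewrite {1}/f e.
  by apply: eq_bigr => k _; rewrite liftK.
exists c => // r x x0; rewrite -fg//; have gx0 := gp r x x0.
by case: (unliftP ord0 r) gx0 => [k ->|->] gx0; [rewrite fc|rewrite hc].
Qed.

(** The factor [c b] common to all routes is multiplicative in [b], being the
    effect of a scaling, and decreasing like the [g r]; hence it is a power. *)
Lemma common_factor_powR {R : realType} {n : nat} (g : 'I_n.+1 -> R -> R) :
  (forall r, pos_decreasing_bijection (g r)) ->
  (forall b, 0 < b -> exists2 c, 0 < c &
    forall r x, 0 < x -> g r (b * x) = c * g r x) ->
  exists2 a, 0 < a & forall r x, 0 < x -> g r x = g r 1 * x `^ (- a).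
Proof.
move=> hg gc.
have gp r : forall x, 0 < x -> 0 < g r x by case: (hg r).
pose c b := g ord0 b / g ord0 1.
have g1 r : g r 1 != 0 by exact/lt0r_neq0/gp.
have gcE r b x : 0 < b -> 0 < x -> g r (b * x) = c b * g r x.
  move=> b0 x0; have [c' _ cP] := gc b b0; rewrite cP//; congr (_ * _).
  by rewrite /c -[in RHS](mulr1 b) cP// mulfK.
have [a a0 aP] : exists2 a, 0 < a & forall x, 0 < x -> c x = x `^ (- a).
  apply: multiplicative_decreasing_powR.
  - by move=> x x0; rewrite divr_gt0// gp.
  - move=> x z x0 xz; rewrite ltr_pM2r ?invr_gt0 ?gp//.
    by case: (hg ord0) => _ gd _; exact: gd.
  - by move=> x z x0 z0; rewrite {1}/c gcE// mulrA.
by exists a => // r x x0; rewrite -aP// mulrC -gcE// mulr1.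
Qed.

(** * Isoelastic utilities *)

Definition isoelastic {R : realType} (alpha w x : R) : R :=
  if alpha == 1 then w * ln x else w / (1 - alpha) * x `^ (1 - alpha).

Lemma is_derive_isoelastic {R : realType} (alpha w x : R) : 0 < x ->
  is_derive x 1 (isoelastic alpha w) (w * x `^ (- alpha)).
Proof.
move=> x0; rewrite /isoelastic; have [->|a1] := eqVneq alpha 1.
  have := is_derive1_ln x0 => ?.
  have -> : w * x `^ (- 1) = w *: x^-1 by rewrite powR_inv1// ltW.
  exact: is_deriveZ.
have := is_derive1_powR (1 - alpha) x0 => ?.
have -> : w * x `^ (- alpha) =
    (w / (1 - alpha)) *: ((1 - alpha) * x `^ (1 - alpha - 1)).
  rewrite (_ : 1 - alpha - 1 = - alpha); last by ring.
  by rewrite /GRing.scale/= mulrA divfK// subr_eq0 eq_sym.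
exact: is_deriveZ.
Qed.

Lemma eq_derive_pos_increment {R : realType} (f h df : R -> R) :
  (forall x : R, 0 < x -> is_derive x 1 f (df x)) ->
  (forall x : R, 0 < x -> is_derive x 1 h (df x)) ->
  forall x z : R, 0 < x -> 0 < z -> f z - f x = h z - h x.
Proof.
move=> hf hh.
suff main (x z : R) : 0 < x -> x < z -> f z - f x = h z - h x.
  move=> x z x0 z0; have [xz|zx|->] := ltgtP x z; first exact: main.
    by have := main z x z0 zx; lra.
  by rewrite !subrr.
move=> x0 xz.
have D (t : R) : 0 < t -> is_derive t 1 (f - h) (df t - df t).
  by move=> t0; have := hf t t0; have := hh t t0 => ? ?; exact: is_deriveB.
have [t tx| |c _] := @MVT R (f - h) (fun t => df t - df t) x z xz.
- by apply: D; move: tx; rewrite in_itv/= => /andP[/(lt_trans x0)].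
- apply: derivable_within_continuous => t; rewrite in_itv/= => /andP[xt _].
  by case: (D t (lt_le_trans x0 xt)).
rewrite subrr mul0r => e; have : f z - h z - (f x - h x) = 0 := e; lra.
Qed.

Lemma alpha_fair_isoelastic {R : realType} {n : nat} (alpha : R) (w y : 'cV[R]_n) :
  alpha_fair alpha w y = network_utility (fun r => isoelastic alpha (w r 0)) y.
Proof.
apply/funext => L; rewrite /alpha_fair /network_utility /isoelastic.
have [_|_] := eqVneq alpha 1; congr (_ * _); apply: eq_bigr => r _; ring.
Qed.

Lemma maximizers_affine {R : realType} {T : Type} (S : set T) (f h : T -> R) p q :
  0 < p -> (forall x, S x -> h x = p * f x + q) ->
  maximizers S h = maximizers S f.
Proof.
move=> p0 hE; apply/seteqP; split=> x [Sx xmax]; split=> // z Sz.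
  by have := xmax z Sz; rewrite !hE// lerD2r ler_pM2l.
by rewrite !hE// lerD2r ler_pM2l//; exact: xmax.
Qed.

(** Scaling the argument acts on all isoelastic utilities of exponent [alpha] by
    an affine change with a common slope; only the intercept depends on the
    weight. *)
Lemma isoelastic_scale {R : realType} (alpha : R) : forall a, 0 < a ->
  exists p q : R, 0 < p /\ forall w x, 0 < x ->
    isoelastic alpha w (a * x) = p * isoelastic alpha w x + w * q.
Proof.
move=> a a0; rewrite /isoelastic; have [_|a1] := eqVneq alpha 1.
  exists 1, (ln a); split=> // w x x0; rewrite lnM ?posrE//; ring.
exists (a `^ (1 - alpha)), 0; split; first exact: powR_gt0.
move=> w x x0; rewrite powRM ?ltW//; ring.
Qed.

(** By the common slope of [isoelastic_scale], the objective at [a *: y] is an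
    increasing affine function of the objective at [y]. *)
Lemma maximizers_alpha_fair_scale {R : realType} {m n : nat} (A : 'M[R]_(m, n))
    (C : 'cV[R]_m) (alpha a : R) (w y : 'cV[R]_n) :
  0 < a -> positive_vec y ->
  maximizers (feasible A C) (alpha_fair alpha w (a *: y)) =
  maximizers (feasible A C) (alpha_fair alpha w y).
Proof.
move=> a0 y0; rewrite !alpha_fair_isoelastic.
have ai : 0 < a^-1 by rewrite invr_gt0.
have [p [q [p0 scaleE]]] := isoelastic_scale alpha a^-1 ai.
apply: (@maximizers_affine _ _ _ _ _ p
  ((\sum_i y i 0)^-1 * \sum_r y r 0 * (w r 0 * q)) p0) => L [L0 _].
rewrite /network_utility.
have -> : \sum_i (a *: y) i 0 = a * \sum_i y i 0.
  by rewrite mulr_sumr; apply: eq_bigr => i _; rewrite mxE.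
have -> : \sum_r (a *: y) r 0 * isoelastic alpha (w r 0) (L r 0 / (a *: y) r 0) =
    a * (p * (\sum_r y r 0 * isoelastic alpha (w r 0) (L r 0 / y r 0)) +
         \sum_r y r 0 * (w r 0 * q)).
  rewrite mulr_sumr -big_split mulr_sumr; apply: eq_bigr => r _; rewrite mxE /=.
  have -> : L r 0 / (a * y r 0) = a^-1 * (L r 0 / y r 0).
    by rewrite invfM mulrCA.
  by rewrite scaleE ?divr_gt0//; ring.
rewrite invfM mulrACA mulVf ?lt0r_neq0// mul1r; ring.
Qed.

Theorem theorem6p1 (R : realType) (K : nat) (hK : (1 < K)%N)
  (C : 'cV[R]_K) (hC : positive_vec C)
  (U : 'I_K.+1 -> R -> R)
  (hUincr : forall r, increasing_pos (U r))
  (hUdiff : forall r, differentiable_pos (U r))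
  (hUconc : forall r, strictly_concave_pos (U r))
  (hUrange : forall r, derivative_range_pos (U r)) :
  flow_scalable (linear_network R K) C U <->
  exists (alpha : R) (w : 'cV[R]_K.+1),
    [/\ 0 < alpha, positive_vec w &
        maximizes_alpha_fair (linear_network R K) C U alpha w].
Proof.
have K0 : (0 < K)%N by exact: ltnW.
pose g r := derive1 (U r).
have Ug r : strict_supergradient_pos (U r) (g r).
  exact: strict_supergradient_derive1.
have hg r : pos_decreasing_bijection (g r).
  have gE := hUrange r; split; last 1 first.
  - move=> v v0; have : [set v | 0 < v] v by [].
    by rewrite -gE => -[x x0 <-]; exists x.
  - by move=> x x0; have : [set v | 0 < v] (g r x) by rewrite -gE; exists x.
  - exact: strict_supergradient_decr (Ug r).
have gp r : forall x, 0 < x -> 0 < g r x by case: (hg r).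
split; last first.
  move=> [alpha [w [_ _ wmax]]] a y a0 y0.
  have ay0 : positive_vec (a *: y) by move=> r; rewrite mxE mulr_gt0.
  (* The two singletons of maximizers coincide, hence so do their elements. *)
  have : [set allocation (linear_network R K) C U y] =
         [set allocation (linear_network R K) C U (a *: y)].
    by rewrite -!wmax// maximizers_alpha_fair_scale.
  by move=> /seteqP[+ _] => /(_ _ erefl).
move=> fs.
have [b b0|alpha alpha0 gE] := common_factor_powR g hg.
  apply: scaled_balance_common_factor => // u u0.
  exact: (flow_scalable_balanced U g C K0 hC Ug hg fs).
exists alpha, (\col_r g r 1); split=> // [r|y y0]; first by rewrite mxE gp.
have [L [L0 tL bL]] := exists_tight_balanced g C y K0 hg hC y0.
(* The same balanced tight vector [L] is optimal for [U] and for the isoelastic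
   utilities, as both have the marginal utilities [g]. *)
rewrite (allocation_maximizers1 _ _ _ _ L); last first.
  exact: maximizers_tight_balanced Ug gp y0 L0 tL bL.
rewrite alpha_fair_isoelastic.
apply: maximizers_tight_balanced gp y0 L0 tL bL => r x z x0 z0 xz.
rewrite mxE.
have := eq_derive_pos_increment (U r) (isoelastic alpha (g r 1)) (g r).
have dU (t : R) : 0 < t -> is_derive t 1 (U r) (g r t).
  by move=> t0; rewrite /g derive1E; apply/derivableP/hUdiff.
have dV (t : R) : 0 < t -> is_derive t 1 (isoelastic alpha (g r 1)) (g r t).
  by move=> t0; rewrite (gE r t)//; exact: is_derive_isoelastic.
move=> /(_ dU dV x z x0 z0).
by have := Ug r x z x0 z0 xz; lra.
Qed.
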